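(* Let $\alpha=\mathbf{CPlant}(\{x'=\theta\,\&\,H\},\Delta_\alpha)$ and $\beta=\mathbf{CPlant}(\{y'=\eta\,\&\,Q\},\Delta_\beta)$ be non-interfering controllable plants satisfying compatible contracts $(A_\alpha,G_\alpha)$ and $(A_\beta,G_\beta)$ (with initial conditions $\mathit{Init}_\alpha,\mathit{Init}_\beta$, in environment $\mathit{Env}$), and let $J_{\mathrm{cmp}}$ be a composition invariant for $\alpha$ and $\beta$. Then $$(\mathit{Env}\wedge A_\alpha\wedge\mathit{Init}_\alpha\wedge A_\beta\wedge\mathit{Init}_\beta)\rightarrow[(\alpha\parallel\beta)^*](G_\alpha\wedge G_\beta)$$ is valid.
   Context: Differential dynamic logic ($d\mathcal{L}$): $\{x'=\theta\,\&\,H\}$ evolves along the ODE for any duration $r\ge0$ with $H$ true throughout; $\alpha^*$ repeats $\alpha$ finitely often nondeterministically; $[\alpha]\varphi$ holds iff $\varphi$ holds after all runs of $\alpha$; validity means truth in all states. $\mathrm{BV}$ and $\mathrm{FV}$ are bound and free variables. $t$ is a global clock not occurring in the plant equations. $\mathbf{CPlant}(\{x'=\theta\,\&\,H\},\Delta)\equiv\{x'=\theta,\ t'=1\,\&\,H\wedge t\ge0\wedge t\le\Delta\}$ and $\alpha\parallel\beta\equiv\mathbf{CPlant}(\{x'=\theta,\ y'=\eta\,\&\,H\wedge Q\},\min(\Delta_\alpha,\Delta_\beta))$. Non-interference: $\mathrm{BV}(\{x'=\theta\,\&\,H\})\cap\mathrm{FV}(\eta)=\emptyset$, $\mathrm{BV}(\{y'=\eta\,\&\,Q\})\cap\mathrm{FV}(\theta)=\emptyset$,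 $\mathrm{BV}(\{x'=\theta\,\&\,H\})\cap\mathrm{FV}(G_\beta)=\emptyset$, $\mathrm{BV}(\{y'=\eta\,\&\,Q\})\cap\mathrm{FV}(G_\alpha)=\emptyset$. $\mathit{Env}$ is a formula with $\mathrm{FV}(\mathit{Env})\cap\mathrm{BV}(\gamma)=\emptyset$ for all components $\gamma$. A component $\gamma$ satisfies contract $(A_\gamma,G_\gamma)$ if $(\mathit{Env}\wedge A_\gamma\wedge\mathit{Init}_\gamma)\rightarrow[\gamma^*]G_\gamma$ is valid. $J_{\mathrm{cmp}}$ is a composition invariant if $J_{\mathrm{cmp}}\rightarrow[\alpha]J_{\mathrm{cmp}}$, $J_{\mathrm{cmp}}\rightarrow[\beta]J_{\mathrm{cmp}}$ and $\mathit{Init}_\alpha\wedge\mathit{Init}_\beta\rightarrow J_{\mathrm{cmp}}$ are valid. The contracts are compatible if $A_\alpha\rightarrow[\beta](G_\beta\wedge J_{\mathrm{cmp}}\rightarrow A_\alpha)$ and $A_\beta\rightarrow[\alpha](G_\alpha\wedge J_{\mathrm{cmp}}\rightarrow A_\beta)$ are valid.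
   Formalization: The formal theorem adds that H and Δ_α do not mention variables bound by {y'=η & Q}, and that Q and Δ_β do not mention variables bound by {x'=θ & H}; without this the claim fails (e.g. x'=1 & x≤y with y'=1 and G_α: x≤0). *)

(* Defs.v *)
From Stdlib Require Import Reals List Relations.
Import ListNotations.
Open Scope R_scope.

(** * Syntax of differential dynamic logic *)

Definition var := nat.

Inductive term : Type :=
| Var (x : var)
| Const (c : R)
| Neg (e : term)
| Add (e1 e2 : term)
| Sub (e1 e2 : term)
| Mul (e1 e2 : term)
| Div (e1 e2 : term)
| Min (e1 e2 : term).

(** [(x, e)] stands for the equation x' = e. *)
Definition ode := list (var * term).

Inductive formula : Type :=
| Le (e1 e2 : term)
| Lt (e1 e2 : term)
| Eq (e1 e2 : term)
| Not (p : formula)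
| And (p q : formula)
| Or (p q : formula)
| Imp (p q : formula)
| All (x : var) (p : formula)
| Ex (x : var) (p : formula)
| Box (a : program) (p : formula)
| Dia (a : program) (p : formula)
with program : Type :=
| Assign (x : var) (e : term)
| AssignAny (x : var)
| Test (p : formula)
| Evolve (o : ode) (H : formula)
| Choice (a b : program)
| Seq (a b : program)
| Star (a : program).

Definition Ge (e1 e2 : term) : formula := Le e2 e1.

(** * Semantics *)

Definition state := var -> R.

Definition upd (s : state) (x : var) (r : R) : state :=
  fun v => if Nat.eq_dec v x then r else s v.

Fixpoint eval (s : state) (e : term) : R :=
  match e with
  | Var x => s x
  | Const c => c
  | Neg e => - eval s e
  | Add e1 e2 => eval s e1 + eval s e2
  | Sub e1 e2 => eval s e1 - eval s e2
  | Mul e1 e2 => eval s e1 * eval s e2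
  | Div e1 e2 => eval s e1 / eval s e2
  | Min e1 e2 => Rmin (eval s e1) (eval s e2)
  end.

Definition ode_vars (o : ode) (v : var) : Prop := In v (map fst o).

(** [phi] solves [o] on [[0, r]] from [s].  [D_in] is the derivative relative to
    [[0, r]], hence one-sided at the endpoints and unconstrained when [r = 0];
    the variables without an equation keep their initial value. *)
Definition solves (o : ode) (r : R) (phi : R -> state) (s : state) : Prop :=
  phi 0 = s /\
  (forall z, 0 <= z <= r ->
     (forall x e, In (x, e) o ->
        D_in (fun u => phi u x) (fun u => eval (phi u) e)
             (fun u => 0 <= u <= r) z) /\
     (forall v, ~ ode_vars o v -> phi z v = s v)).

Fixpoint sat (p : formula) (s : state) : Prop :=
  match p with
  | Le e1 e2 => eval s e1 <= eval s e2
  | Lt e1 e2 => eval s e1 < eval s e2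
  | Eq e1 e2 => eval s e1 = eval s e2
  | Not p => ~ sat p s
  | And p q => sat p s /\ sat q s
  | Or p q => sat p s \/ sat q s
  | Imp p q => sat p s -> sat q s
  | All x p => forall r, sat p (upd s x r)
  | Ex x p => exists r, sat p (upd s x r)
  | Box a p => forall s', run a s s' -> sat p s'
  | Dia a p => exists s', run a s s' /\ sat p s'
  end
with run (a : program) (s s' : state) : Prop :=
  match a with
  | Assign x e => s' = upd s x (eval s e)
  | AssignAny x => exists r, s' = upd s x r
  | Test p => s' = s /\ sat p s
  | Evolve o H =>
      exists (r : R) (phi : R -> state),
        0 <= r /\ solves o r phi s /\ phi r = s' /\
        (forall z, 0 <= z <= r -> sat H (phi z))
  | Choice a b => run a s s' \/ run b s s'
  | Seq a b => exists m, run a s m /\ run b m s'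
  | Star a => clos_refl_trans state (run a) s s'
  end.

Definition valid (p : formula) : Prop := forall s, sat p s.

(** * Static semantics: free, bound and must-bound variables *)

Fixpoint FVt (e : term) (v : var) : Prop :=
  match e with
  | Var x => v = x
  | Const _ => False
  | Neg e => FVt e v
  | Add e1 e2 | Sub e1 e2 | Mul e1 e2 | Div e1 e2 | Min e1 e2 =>
      FVt e1 v \/ FVt e2 v
  end.

(** Free variables of the vector of right-hand sides of a system. *)
Definition FVrhs (o : ode) (v : var) : Prop :=
  exists x e, In (x, e) o /\ FVt e v.

Fixpoint BV (a : program) (v : var) : Prop :=
  match a with
  | Assign x _ | AssignAny x => v = x
  | Test _ => False
  | Evolve o _ => ode_vars o v
  | Choice a b | Seq a b => BV a v \/ BV b v
  | Star a => BV a v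
  end.

(** Variables written on every run; needed for the free variables of
    [Box], [Dia] and [Seq]. *)
Fixpoint MBV (a : program) (v : var) : Prop :=
  match a with
  | Assign x _ | AssignAny x => v = x
  | Test _ => False
  | Evolve o _ => ode_vars o v
  | Choice a b => MBV a v /\ MBV b v
  | Seq a b => MBV a v \/ MBV b v
  | Star _ => False
  end.

Fixpoint FV (p : formula) (v : var) : Prop :=
  match p with
  | Le e1 e2 | Lt e1 e2 | Eq e1 e2 => FVt e1 v \/ FVt e2 v
  | Not p => FV p v
  | And p q | Or p q | Imp p q => FV p v \/ FV q v
  | All x p | Ex x p => FV p v /\ v <> x
  | Box a p | Dia a p => FVp a v \/ (FV p v /\ ~ MBV a v)
  end
with FVp (a : program) (v : var) : Prop :=
  match a with
  | Assign _ e => FVt e v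
  | AssignAny _ => False
  | Test p => FV p v
  | Evolve o H => ode_vars o v \/ FVrhs o v \/ FV H v
  | Choice a b => FVp a v \/ FVp b v
  | Seq a b => FVp a v \/ (FVp b v /\ ~ MBV a v)
  | Star a => FVp a v
  end.

Definition disjoint (A B : var -> Prop) : Prop := forall v, ~ (A v /\ B v).

(** * Controllable plants and contracts *)

(** The plant {x' = theta & H}. *)
Record plant := Plant { eqs : ode; dom : formula }.

Definition plant_prog (p : plant) : program := Evolve (eqs p) (dom p).

Definition clock_dom (t : var) (H : formula) (Delta : term) : formula :=
  And (And H (Ge (Var t) (Const 0))) (Le (Var t) Delta).

Definition CPlant (t : var) (p : plant) (Delta : term) : program :=
  Evolve (eqs p ++ [(t, Const 1)]) (clock_dom t (dom p) Delta).

Definition plant_join (p q : plant) : plant :=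
  Plant (eqs p ++ eqs q) (And (dom p) (dom q)).

Definition par (t : var) (p : plant) (Da : term) (q : plant) (Db : term)
  : program :=
  CPlant t (plant_join p q) (Min Da Db).

Definition clock_fresh (t : var) (p : plant) : Prop :=
  ~ ode_vars (eqs p) t /\ ~ FVrhs (eqs p) t.

Definition noninterfering (p q : plant) (Ga Gb : formula) : Prop :=
  disjoint (BV (plant_prog p)) (FVrhs (eqs q)) /\
  disjoint (BV (plant_prog q)) (FVrhs (eqs p)) /\
  disjoint (BV (plant_prog p)) (FV Gb) /\
  disjoint (BV (plant_prog q)) (FV Ga).

(** An evolution domain (and the duration bound in it) belongs to its own plant:
    it does not read the variables driven by the other one.  [noninterfering]
    does not say this about [dom], and the composition theorem is false without
    it: take {x' = 1 & x <= y} and {y' = 1}, both with bound 1, guarantees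
    x <= 0 and true, initial condition x = 0 /\ y = 0 /\ t = 0 and everything
    else true.  With y frozen the first plant never leaves x <= 0, but the
    composition reaches x = 1. *)
Definition own_domain (t : var) (p : plant) (Da : term) (q : plant) : Prop :=
  disjoint (BV (plant_prog q)) (FV (clock_dom t (dom p) Da)).

Definition satisfies_contract (Env A Init : formula) (c : program) (G : formula)
  : Prop :=
  valid (Imp (And (And Env A) Init) (Box (Star c) G)).

Definition composition_invariant (J : formula) (a b : program)
    (InitA InitB : formula) : Prop :=
  valid (Imp J (Box a J)) /\
  valid (Imp J (Box b J)) /\
  valid (Imp (And InitA InitB) J).

Definition compatible (a b : program) (Aa Ga Ab Gb J : formula) : Prop :=
  valid (Imp Aa (Box b (Imp (And Gb J) Aa))) /\
  valid (Imp Ab (Box a (Imp (And Ga J) Ab))).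

(* Main.v *)
(** Freezing the variables of the second plant turns a run of the composition
    into a run of the first one: by non-interference neither its equations, nor
    its domain and duration bound, read the frozen variables.  Iterating, each
    run of [(a || b)^*] from [s] projects to a run of [a^*] that starts in the
    same [s] and ends in a state differing from the true one only on variables
    driven by the second plant alone.  The guarantee of the first component holds
    there by its contract, and it does not read those variables; the other
    guarantee is symmetric.  Formulas may contain modalities, so "does not read"
    rests on the coincidence theorem of the full logic. *)

Require Import Defs.
From Stdlib Require Import Reals List Relations Classical FunctionalExtensionality.
Import ListNotations.
Open Scope R_scope.

(** * Agreement of states, and terms *)

Definition agree (V : var -> Prop) (s m : state) : Prop :=
  forall v, V v -> s v = m v.

Lemma agree_sym (V : var -> Prop) (s m : state) : agree V s m -> agree V m s.
Proof. intros H v Hv; symmetry; auto. Qed.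

Lemma agree_sub (V W : var -> Prop) (s m : state) :
  (forall v, W v -> V v) -> agree V s m -> agree W s m.
Proof. intros HW H v Hv; auto. Qed.

Lemma agree_or (V W : var -> Prop) (s m : state) :
  agree (fun v => V v \/ W v) s m -> agree V s m /\ agree W s m.
Proof. intros H; split; intros v Hv; apply H; auto. Qed.

Lemma eval_agree (e : term) (s m : state) :
  agree (FVt e) s m -> eval s e = eval m e.
Proof.
  induction e; simpl; intros H;
    [ apply H; reflexivity | reflexivity | rewrite IHe; auto | .. ];
    rewrite IHe1, IHe2; auto;
    eapply agree_sub; try exact H; simpl; auto.
Qed.

Lemma in_ode_vars (o : ode) (x : var) (e : term) : In (x, e) o -> ode_vars o x.
Proof. intros H; exact (in_map fst o (x, e) H). Qed.

(** * Restricting solutions to a subsystem *)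

Definition overlay (o : ode) (m s : state) : state :=
  fun v => if in_dec Nat.eq_dec v (map fst o) then s v else m v.

Lemma overlay_in (o : ode) (m s : state) (v : var) :
  ode_vars o v -> overlay o m s v = s v.
Proof.
  unfold overlay, ode_vars; intros H.
  destruct (in_dec Nat.eq_dec v (map fst o)); tauto.
Qed.

Lemma overlay_out (o : ode) (m s : state) (v : var) :
  ~ ode_vars o v -> overlay o m s v = m v.
Proof.
  unfold overlay, ode_vars; intros H.
  destruct (in_dec Nat.eq_dec v (map fst o)); tauto.
Qed.

Lemma overlay_agree (o : ode) (m s : state) :
  agree (ode_vars o) m s -> overlay o m s = m.
Proof.
  intros H; apply functional_extensionality; intros v.
  unfold overlay.
  destruct (in_dec Nat.eq_dec v (map fst o)); [symmetry; apply H; assumption | reflexivity].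
Qed.

(** [transferred o o' s m] collects the variables on which a solution of [o]
    from [s] and its restriction to the subsystem [o'], started in [m], agree. *)
Definition transferred (o o' : ode) (s m : state) (v : var) : Prop :=
  ode_vars o' v \/ (~ ode_vars o v /\ m v = s v).

(** A variable of [o'] is copied from [phi]. Any other transferred variable is not driven by [o], so
    along [phi] it keeps the value that [s] and [m] share. *)
Lemma overlay_transferred (o o' : ode) (r z : R) (phi : R -> state) (s m : state) :
  solves o r phi s -> 0 <= z <= r ->
  agree (transferred o o' s m) (phi z) (overlay o' m (phi z)).
Proof.
  intros [_ Hsol] Hz v Hv.
  destruct (classic (ode_vars o' v)) as [Hin | Hout].
  - symmetry; apply overlay_in; assumption.
  - destruct Hv as [Hin | [Hno Hms]]; [contradiction |].
    rewrite (overlay_out _ _ _ _ Hout), Hms.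
    exact (proj2 (Hsol z Hz) v Hno).
Qed.

Lemma solves_subsystem (o o' : ode) (r : R) (phi : R -> state) (s m : state) :
  incl o' o ->
  agree (ode_vars o') m s ->
  (forall v, FVrhs o' v -> transferred o o' s m v) ->
  solves o r phi s ->
  solves o' r (fun u => overlay o' m (phi u)) m.
Proof.
  intros Hincl Hms Hfv Hphi.
  pose proof Hphi as [H0 Hsol].
  split; [rewrite H0; apply overlay_agree; assumption |].
  intros z Hz; split.
  - intros x e Hxe.
    pose proof (proj1 (Hsol z Hz) x e (Hincl _ Hxe)) as HD.
    replace (fun u => overlay o' m (phi u) x) with (fun u => phi u x).
    2: { apply functional_extensionality; intros u; symmetry.
         apply overlay_in; eapply in_ode_vars; eassumption. }
    (* [D_in] uses its derivative function only at the point [z], so agreement of the two states at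
       [z] suffices. *)
    unfold D_in in *.
    rewrite <- (eval_agree e (phi z) (overlay o' m (phi z))); [assumption |].
    apply agree_sub with (V := transferred o o' s m).
    + intros v Hv; apply Hfv; exists x, e; auto.
    + eapply overlay_transferred; eassumption.
  - intros v Hv; apply overlay_out; assumption.
Qed.

(** * The coincidence theorem *)

Definition coincident (D : formula) : Prop :=
  forall s m, agree (FV D) s m -> sat D s -> sat D m.

(** [V] may exceed the free variables because the second half of a [Seq] starts from agreement on
    [V] enlarged by what the first half must bind. *)
Definition run_coincident (a : program) : Prop :=
  forall (V : var -> Prop) s m s',
    (forall v, FVp a v -> V v) -> agree V s m -> run a s s' ->
    exists m', run a m m' /\ agree (fun v => V v \/ MBV a v) s' m'.

(** Serves twice: with [o' = o] as the [Evolve] case of coincidence, and with [o'] a component of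
    the composition. Coincidence of [D'] is a hypothesis since the first use has it only by
    induction. *)
Lemma run_evolve_subsystem (o o' : ode) (D D' : formula) (s m s' : state) :
  incl o' o ->
  (forall st, sat D st -> sat D' st) ->
  coincident D' ->
  agree (ode_vars o') m s ->
  (forall v, FVrhs o' v \/ FV D' v -> transferred o o' s m v) ->
  run (Evolve o D) s s' ->
  run (Evolve o' D') m (overlay o' m s') /\
  agree (transferred o o' s m) s' (overlay o' m s').
Proof.
  intros Hincl HD Hco Hms Hfv (r & phi & Hr & Hphi & Hend & Hdom).
  subst s'; split.
  - exists r, (fun u => overlay o' m (phi u)).
    split; [assumption |]; split; [| split; [reflexivity |]].
    + eapply solves_subsystem; eauto.
    + intros z Hz; apply Hco with (phi z); [| auto].
      apply agree_sub with (V := transferred o o' s m); [auto |].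
      eapply overlay_transferred; eassumption.
  - eapply overlay_transferred; [eassumption |].
    split; [assumption | apply Rle_refl].
Qed.

Scheme formula_mutind := Induction for formula Sort Prop
  with program_mutind := Induction for program Sort Prop.
Combined Scheme formula_program_ind from formula_mutind, program_mutind.

Lemma agree_upd (V W : var -> Prop) (s m : state) (x : var) (r : R) :
  (forall v, W v -> V v \/ v = x) -> agree V s m -> agree W (upd s x r) (upd m x r).
Proof.
  intros HW H v Hv; unfold upd.
  destruct (Nat.eq_dec v x); [reflexivity |].
  destruct (HW v Hv); [auto | contradiction].
Qed.

Lemma coincidence :
  (forall D, coincident D) /\ (forall a, run_coincident a).
Proof.
  apply formula_program_ind; unfold coincident, run_coincident; simpl.
  1-3: intros e1 e2 s m [H1 H2]%agree_or;
    rewrite (eval_agree e1 s m H1), (eval_agree e2 s m H2); auto.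
  - intros D IH s m H Hs Hm; apply Hs; eauto using agree_sym.
  - intros D IHD E IHE s m [H1 H2]%agree_or [Hs1 Hs2]; eauto.
  - intros D IHD E IHE s m [H1 H2]%agree_or [Hs | Hs]; eauto.
  - intros D IHD E IHE s m [H1 H2]%agree_or Hs Hm.
    eauto using agree_sym.
  - intros x D IH s m H Hs r.
    apply (IH (upd s x r)); [| auto].
    eapply agree_upd; [| exact H].
    intros v Hv; simpl; destruct (Nat.eq_dec v x); auto.
  - intros x D IH s m H [r Hr]; exists r.
    apply (IH (upd s x r)); [| auto].
    eapply agree_upd; [| exact H].
    intros v Hv; simpl; destruct (Nat.eq_dec v x); auto.
  (* For [Box], a run from [m] is matched by one from [s], hence the reversed agreement. *)
  - intros a IHa D IHD s m H Hs m' Hm.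
    destruct (IHa _ m s m' (fun v Hv => or_introl Hv) (agree_sym _ _ _ H) Hm)
      as (s' & Hrun & Hag).
    apply (IHD s'); [| auto].
    apply agree_sym; eapply agree_sub; [| exact Hag].
    intros v Hv; simpl; destruct (classic (MBV a v)); auto.
  - intros a IHa D IHD s m H (s' & Hrun & Hs').
    destruct (IHa _ s m s' (fun v Hv => or_introl Hv) H Hrun) as (m' & Hm' & Hag).
    exists m'; split; [assumption |].
    apply (IHD s'); [| auto].
    eapply agree_sub; [| exact Hag].
    intros v Hv; simpl; destruct (classic (MBV a v)); auto.
  - intros x e V s m s' HV H ->.
    exists (upd m x (eval m e)); split; [reflexivity |].
    rewrite (eval_agree e s m) by eauto using agree_sub.
    eapply agree_upd; [| exact H]; auto.
  - intros x V s m s' HV H [r ->].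
    exists (upd m x r); split; [eauto |].
    eapply agree_upd; [| exact H]; auto.
  - intros D IH V s m s' HV H [-> Hs].
    exists m; split; [split; [reflexivity | eauto using agree_sub] |].
    eapply agree_sub; [| exact H]; simpl; tauto.
  - intros o D IH V s m s' HV H Hrun.
    assert (Htr : forall v, V v -> transferred o o s m v).
    { intros v Hv; unfold transferred.
      destruct (classic (ode_vars o v)); [auto | right; split; [assumption |]].
      symmetry; auto. }
    destruct (run_evolve_subsystem o o D D s m s') as [Hm Hag]; auto.
    + apply incl_refl.
    + intros v Hv; symmetry; auto.
    + exists (overlay o m s'); split; [exact Hm |].
      eapply agree_sub; [| exact Hag].
      intros v [Hv | Hv]; [auto | left; assumption].
  - intros a IHa b IHb V s m s' HV H [Hrun | Hrun].
    + destruct (IHa V s m s') as (m' & Hm' & Hag); auto.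
      exists m'; split; [auto |].
      eapply agree_sub; [| exact Hag]; simpl; tauto.
    + destruct (IHb V s m s') as (m' & Hm' & Hag); auto.
      exists m'; split; [auto |].
      eapply agree_sub; [| exact Hag]; simpl; tauto.
  - intros a IHa b IHb V s m s' HV H (s1 & Hr1 & Hr2).
    destruct (IHa V s m s1) as (m1 & Hm1 & Hag1); auto.
    destruct (IHb (fun v => V v \/ MBV a v) s1 m1 s') as (m' & Hm' & Hag);
      [| exact Hag1 | exact Hr2 |].
    + intros v Hv; simpl; destruct (classic (MBV a v)); auto.
    + exists m'; split; [eauto |].
      eapply agree_sub; [| exact Hag]; simpl; tauto.
  - intros a IHa V s m s' HV H Hrun.
    (* [Star] must bind nothing, so agreement on [V] alone is kept; it chains along iterations. *)
    enough (exists m', clos_refl_trans state (run a) m m' /\ agree V s' m')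
      as (m' & Hm' & Hag).
    { exists m'; split; [assumption |].
      eapply agree_sub; [| exact Hag]; simpl; tauto. }
    revert m H; induction Hrun as [s s' Hstep | s | s s1 s' _ IH1 _ IH2]; intros m H.
    + destruct (IHa V s m s') as (m' & Hm' & Hag); auto.
      exists m'; split; [apply rt_step; assumption |].
      eapply agree_sub; [| exact Hag]; simpl; tauto.
    + exists m; split; [apply rt_refl | assumption].
    + destruct (IH1 m H) as (m1 & Hm1 & Hag1).
      destruct (IH2 m1 Hag1) as (m' & Hm' & Hag).
      exists m'; split; [eapply rt_trans; eassumption | assumption].
Qed.

(** * Projecting the composition to a component *)

(** Variables on which the projection of a run of the composition to the
    plant [p] follows that run, when [q] is the other plant. *)
Definition tracked (p q : plant) (v : var) : Prop :=
  ode_vars (eqs p) v \/ ~ ode_vars (eqs q) v.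

(** The equations of the composition are given by the variables they bind,
    so that the statement applies to either component. *)
Lemma project_step (t : var) (p q : plant) (Da : term) (o : ode) (D : formula)
  (s m s' : state) :
  ~ ode_vars (eqs q) t ->
  disjoint (BV (plant_prog q)) (FVrhs (eqs p)) ->
  own_domain t p Da q ->
  incl (eqs p ++ [(t, Const 1)]) o ->
  (forall v, ode_vars o v -> ode_vars (eqs p) v \/ ode_vars (eqs q) v \/ v = t) ->
  (forall st, sat D st -> sat (clock_dom t (dom p) Da) st) ->
  agree (tracked p q) s m ->
  run (Evolve o D) s s' ->
  exists m', run (CPlant t p Da) m m' /\ agree (tracked p q) s' m'.
Proof.
  intros Ht Hrhs Hown Hincl Hvars HD Hag Hrun.
  set (o' := eqs p ++ [(t, Const 1)]) in *.
  assert (Ho' : forall v, ode_vars o' v <-> ode_vars (eqs p) v \/ v = t).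
  { intros v; unfold o', ode_vars; rewrite map_app, in_app_iff; simpl.
    split; intuition auto. }
  (* A tracked variable outside [o'] is driven neither by [p] nor by [q] and is not the clock, so
     [o] leaves it constant. *)
  assert (Htr : forall v, tracked p q v -> transferred o o' s m v).
  { intros v Hv; unfold transferred.
    destruct (classic (ode_vars o' v)) as [Hin | Hout]; [auto | right].
    split; [| symmetry; auto].
    rewrite Ho' in Hout; intros Ho; destruct (Hvars v Ho) as [| []];
      destruct Hv; tauto. }
  destruct (run_evolve_subsystem o o' D (clock_dom t (dom p) Da) s m s')
    as [Hm Hag']; auto.
  - apply coincidence.
  - intros v Hv; symmetry; apply Hag.
    apply Ho' in Hv as [Hv | ->]; [left | right]; assumption.
  - intros v [(x & e & Hxe & Hv) | Hv]; apply Htr; right; intros Hq.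
    + apply in_app_or in Hxe as [Hxe | [Hxe | []]].
      * apply (Hrhs v); split; [exact Hq | exists x, e; auto].
      * injection Hxe as <- <-; contradiction.
    + apply (Hown v); split; assumption.
  - exists (overlay o' m s'); split; [exact Hm |].
    eapply agree_sub; eassumption.
Qed.

Lemma star_simulation (V : var -> Prop) (a b : program) :
  (forall s m s', agree V s m -> run a s s' ->
     exists m', run b m m' /\ agree V s' m') ->
  forall s s', run (Star a) s s' -> exists m', run (Star b) s m' /\ agree V s' m'.
Proof.
  intros Hstep s s' Hrun; simpl in *.
  (* Peeling off the last step keeps the common start [s] fixed while the simulating run grows. *)
  apply clos_rt_rtn1 in Hrun.
  induction Hrun as [| s1 s2 Hs _ (m1 & Hm1 & Hag1)].
  - exists s; split; [apply rt_refl | intros v _; reflexivity].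
  - destruct (Hstep _ _ _ Hag1 Hs) as (m2 & Hm2 & Hag2).
    exists m2; split; [| assumption].
    eapply rt_trans; [eassumption | apply rt_step; assumption].
Qed.

Lemma guarantee_transfer (p q : plant) (a b : program) (G : formula) (s : state) :
  disjoint (BV (plant_prog q)) (FV G) ->
  (forall s m s', agree (tracked p q) s m -> run a s s' ->
     exists m', run b m m' /\ agree (tracked p q) s' m') ->
  sat (Box (Star b) G) s -> sat (Box (Star a) G) s.
Proof.
  intros HG Hstep Hb s' Hrun.
  destruct (star_simulation _ _ _ Hstep _ _ Hrun) as (m' & Hm' & Hag).
  apply (proj1 coincidence G m' s'); [| exact (Hb m' Hm')].
  apply agree_sym; eapply agree_sub; [| exact Hag].
  intros v Hv; right; intros Hq; exact (HG v (conj Hq Hv)).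
Qed.

Theorem theorem3 (t : var) (p q : plant) (Da Db : term)
  (Env Aa Ga InitA Ab Gb InitB J : formula)
  (Hclock_p : clock_fresh t p)
  (Hclock_q : clock_fresh t q)
  (Hdom_p : own_domain t p Da q)
  (Hdom_q : own_domain t q Db p)
  (Hni : noninterfering p q Ga Gb)
  (HEnv_a : disjoint (FV Env) (BV (CPlant t p Da)))
  (HEnv_b : disjoint (FV Env) (BV (CPlant t q Db)))
  (Hca : satisfies_contract Env Aa InitA (CPlant t p Da) Ga)
  (Hcb : satisfies_contract Env Ab InitB (CPlant t q Db) Gb)
  (HJ : composition_invariant J (CPlant t p Da) (CPlant t q Db) InitA InitB)
  (Hcompat : compatible (CPlant t p Da) (CPlant t q Db) Aa Ga Ab Gb J) :
  valid (Imp (And (And (And (And Env Aa) InitA) Ab) InitB)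
             (Box (Star (par t p Da q Db)) (And Ga Gb))).
Proof.
  destruct Hclock_p as [Htp _], Hclock_q as [Htq _].
  destruct Hni as (Hpq & Hqp & HpG & HqG).
  assert (Hvars : forall v, ode_vars ((eqs p ++ eqs q) ++ [(t, Const 1)]) v ->
            ode_vars (eqs p) v \/ ode_vars (eqs q) v \/ v = t).
  { unfold ode_vars; intros v; rewrite !map_app, !in_app_iff; simpl.
    intuition auto. }
  intros s ((((HE & HAa) & HIa) & HAb) & HIb) s' Hrun; split; revert s' Hrun.
  - apply (guarantee_transfer p q _ (CPlant t p Da)); [assumption | |].
    + intros s1 m1 s2; eapply project_step; eauto.
      * intros x; simpl; rewrite !in_app_iff; tauto.
      (* The joint domain implies that of [p], and the joint clock bound is at most [Da]. *)
      * simpl; intros st (((Hp & Hq) & H0) & Hmin).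
        repeat split; try assumption.
        eapply Rle_trans; [exact Hmin | apply Rmin_l].
    + exact (Hca s (conj (conj HE HAa) HIa)).
  - apply (guarantee_transfer q p _ (CPlant t q Db)); [assumption | |].
    + intros s1 m1 s2; eapply project_step; eauto.
      * intros x; simpl; rewrite !in_app_iff; tauto.
      * intros v Hv; destruct (Hvars v Hv) as [| []]; auto.
      * simpl; intros st (((Hp & Hq) & H0) & Hmin).
        repeat split; try assumption.
        eapply Rle_trans; [exact Hmin | apply Rmin_r].
    + exact (Hcb s (conj (conj HE HAb) HIb)).
Qed.
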